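(* Let $\mathcal{K},\mathcal{K}'$ be symmetric cones in Euclidean Jordan algebras $\mathcal{J},\mathcal{J}'$, where $\mathcal{K}$ has rank $r$. Let $c,a_1,\dots,a_m\in\mathcal{J}$, $c',a'_1,\dots,a'_m\in\mathcal{J}'$, $b\in\mathbb{R}^m$, and consider the primal/dual pair of symmetric cone programs $$\max\{c\bullet x+c'\bullet x' : a_j\bullet x+a'_j\bullet x'=b_j\ \forall j\in[m],\ x\in\mathcal{K},\ x'\in\mathcal{K}'\},$$ $$\min\{b^Ty : \textstyle\sum_{j=1}^m a_jy_j\succeq_{\mathcal{K}}c,\ \sum_{j=1}^m a'_jy_j\succeq_{\mathcal{K}'}c',\ y\in\mathbb{R}^m\},$$ for which strong duality holds, with common optimal value $\mathsf{OPT}$. Assume that $a_m=e$ (the identity of $\mathcal{J}$), $a'_m\in\mathcal{K}'$, and write $R=b_m$. Fix an error parameter $\varepsilon>0$ and a guess $\alpha>0$ for $\mathsf{OPT}$. Execute the primal-dual meta-algorithm (described in the context) for $$T=\left\lceil\frac{4R^2\rho^2\ln r}{\varepsilon^2\alpha^2}\right\rceil$$ iterations, using an ORACLE of width $\rho$ and step size $\eta=\sqrt{\ln r/T}$ in the update $$p^{(t+1)}=\frac{1}{C}\exp\Big(-\frac{\eta t}{\rho}\big(\textstyle\sum_{j}a_j\bar y^{(t)}_j-c\big)\Big),\qquad C \text{ such that } \mathrm{Tr}(p^{(t+1)})=1 .$$ Then either the algorithm terminates within these $T$ iterations (the ORACLE reports emptiness) and correctly concludes that $\mathsf{OPT}>\alpha$;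 or the algorithm does not terminate within $T$ iterations, in which case $\mathsf{OPT}\le(1+\varepsilon)\alpha$ and the vector $$\tilde y=\Big(\bar y^{(T)}_1,\ldots,\bar y^{(T)}_{m-1},\ \bar y^{(T)}_m+\frac{\varepsilon\alpha}{R}\Big)$$ is a feasible solution of the dual (minimization) problem with objective value $b^T\tilde y\le(1+\varepsilon)\alpha$.
   Context: A Euclidean Jordan algebra (EJA) is a finite-dimensional real vector space $\mathcal{J}$ with a commutative bilinear product $\circ$ satisfying $x^2\circ(x\circ y)=x\circ(x^2\circ y)$, an inner product satisfying $(x\circ y)\bullet z=x\bullet(y\circ z)$, and an identity element $e$. Its symmetric cone is the cone of squares $\mathcal{K}=\{x\circ x:x\in\mathcal{J}\}$. The rank $r$ is the largest degree of the minimal polynomial of an element. Every $x\in\mathcal{J}$ has a spectral decomposition $x=\sum_{i=1}^r\lambda_iq_i$ with real eigenvalues $\lambda_i$ and a Jordan frame $\{q_1,\dots,q_r\}$ (primitive idempotents with $q_i\circ q_j=0$ for $i\ne j$ and $\sum_iq_i=e$). Define $\mathrm{Tr}(x)=\sum_i\lambda_i$, $\exp(x)=\sum_i e^{\lambda_i}q_i$, $\|x\|_\infty=\max_i|\lambda_i|$. The inner product is $x\bullet y=\mathrm{Tr}(x\circ y)$. Write $x\succeq_{\mathcal{K}}y$ iff $x-y\in\mathcal{K}$, and $[m]=\{1,\dots,m\}$. Strong duality: primal and dual share the finite optimal value $\mathsf{OPT}$, and a dual optimal solution exists. It is assumed that $R>0$ and $T\ge1$. Set $\mathcal{C}=\{y\in\mathbb{R}^m:\sum_ja'_jy_j\succeq_{\mathcal{K}'}c'\}$.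 ORACLE: given $p\in\mathcal{K}$ with $\mathrm{Tr}(p)=1$, it decides whether there is $y\in\mathbb{R}^m$ with $$\big(\textstyle\sum_ja_jy_j-c\big)\bullet p\ge0,\qquad b^Ty\le\alpha,\qquad y\in\mathcal{C},$$ and returns such a $y$ if one exists, otherwise reports emptiness. It has width $\rho>0$ if for every $p\in\mathcal{K}$ with $\mathrm{Tr}(p)=1$, any returned $y$ satisfies $\|\sum_ja_jy_j-c\|_\infty\le\rho$. Meta-algorithm: start with $p^{(1)}=e/r$. In iteration $t=1,2,\dots$, call the ORACLE on $p^{(t)}$. If it reports emptiness, conclude $\mathsf{OPT}>\alpha$ and terminate. Otherwise let $y^{(t)}$ be the returned point, let $\bar y^{(t)}=\frac1t\sum_{\tau=1}^ty^{(\tau)}$, and compute $p^{(t+1)}$ by the update in the claim. *)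

(* Defs.v *)
(* MathComp / MathComp-Analysis. *)
From HB Require Import structures.
From mathcomp Require Import all_boot all_order all_algebra.
From mathcomp Require Import all_classical all_reals all_analysis.

Set Implicit Arguments.
Unset Strict Implicit.
Unset Printing Implicit Defensive.
Import Order.TTheory GRing.Theory Num.Theory.
Local Open Scope classical_set_scope.
Local Open Scope ring_scope.

(* The inner product is an arbitrary associative one; its normalisation as the
   trace form, [trace_form] below, is stated separately because the trace is
   defined from the Jordan product. *)
Record eja (R : realType) (J : vectType R) := EJA {
  jmul : J -> J -> J;
  jinner : J -> J -> R;
  jone : J;
  jmulC : forall x y, jmul x y = jmul y x;
  jmul_linear : forall (k : R) x y z,
    jmul (k *: x + y) z = k *: jmul x z + jmul y z;
  jmul_jordan : forall x y,
    jmul (jmul x x) (jmul x y) = jmul x (jmul (jmul x x) y);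
  jmul1 : forall x, jmul jone x = x;
  jinnerC : forall x y, jinner x y = jinner y x;
  jinner_linear : forall (k : R) x y z,
    jinner (k *: x + y) z = k * jinner x z + jinner y z;
  jinner_gt0 : forall x, x != 0 -> 0 < jinner x x;
  jinnerA : forall x y z, jinner (jmul x y) z = jinner x (jmul y z) }.

Definition jpow (R : realType) (J : vectType R) (E : eja J) (x : J) (k : nat) : J :=
  iter k (jmul E x) (jone E).

Definition jeval (R : realType) (J : vectType R) (E : eja J) (f : {poly R}) (x : J) : J :=
  \sum_(i < size f) f`_i *: jpow E x i.

Definition is_minpoly (R : realType) (J : vectType R) (E : eja J) (x : J) (f : {poly R}) :=
  [/\ f \is monic, jeval E f x = 0 &
      forall g : {poly R}, g != 0 -> jeval E g x = 0 -> (size f <= size g)%N].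

Definition is_rank (R : realType) (J : vectType R) (E : eja J) (r : nat) :=
  (exists x f, is_minpoly E x f /\ (size f).-1 = r) /\
  (forall x f, is_minpoly E x f -> ((size f).-1 <= r)%N).

Definition jrank (R : realType) (J : vectType R) (E : eja J) : nat :=
  xget 0%N [set r | is_rank E r].

Definition jcone (R : realType) (J : vectType R) (E : eja J) : set J :=
  [set x | exists z, x = jmul E z z].

Definition idempotent (R : realType) (J : vectType R) (E : eja J) (q : J) :=
  jmul E q q = q.

Definition primitive_idempotent (R : realType) (J : vectType R) (E : eja J) (q : J) :=
  [/\ q != 0, idempotent E q &
      ~ exists u v, [/\ u != 0, v != 0, idempotent E u, idempotent E v & q = u + v]].

Definition jordan_frame (R : realType) (J : vectType R) (E : eja J) (n : nat)
    (q : 'I_n -> J) :=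
  [/\ forall i, primitive_idempotent E (q i),
      forall i j, i != j -> jmul E (q i) (q j) = 0 &
      \sum_i q i = jone E].

Definition is_spectral (R : realType) (J : vectType R) (E : eja J) (n : nat) (x : J)
    (d : {ffun 'I_n -> R} * {ffun 'I_n -> J}) :=
  jordan_frame E d.2 /\ x = \sum_i d.1 i *: d.2 i.

(* A chosen spectral decomposition (eigenvalues, Jordan frame). Every element
   has one, and the functions defined from it do not depend on the choice; the
   default value only makes the definition total. *)
Definition spectral (R : realType) (J : vectType R) (E : eja J) (x : J) :
    {ffun 'I_(jrank E) -> R} * {ffun 'I_(jrank E) -> J} :=
  xget ([ffun=> 0], [ffun=> 0]) [set d | is_spectral E x d].

Definition jtr (R : realType) (J : vectType R) (E : eja J) (x : J) : R :=
  \sum_i (spectral E x).1 i.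

Definition jexp (R : realType) (J : vectType R) (E : eja J) (x : J) : J :=
  \sum_i expR ((spectral E x).1 i) *: (spectral E x).2 i.

Definition jnorm_inf (R : realType) (J : vectType R) (E : eja J) (x : J) : R :=
  \big[Num.max/0]_i `|(spectral E x).1 i|.

Definition trace_form (R : realType) (J : vectType R) (E : eja J) :=
  forall x y, jinner E x y = jtr E (jmul E x y).

Definition slack (R : realType) (J : vectType R) (m : nat) (a : 'I_m -> J) (c : J)
    (y : 'rV[R]_m) : J :=
  \sum_j y 0 j *: a j - c.

Definition objective (R : realType) (m : nat) (b y : 'rV[R]_m) : R :=
  \sum_j b 0 j * y 0 j.

Definition primal_feasible (R : realType) (J J' : vectType R) (E : eja J) (E' : eja J')
    (m : nat) (a : 'I_m -> J) (a' : 'I_m -> J') (b : 'rV[R]_m) : set (J * J') :=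
  [set x | [/\ jcone E x.1, jcone E' x.2 &
    forall j, jinner E (a j) x.1 + jinner E' (a' j) x.2 = b 0 j]].

Definition dual_feasible (R : realType) (J J' : vectType R) (E : eja J) (E' : eja J')
    (m : nat) (c : J) (a : 'I_m -> J) (c' : J') (a' : 'I_m -> J') : set 'rV[R]_m :=
  [set y | jcone E (slack a c y) /\ jcone E' (slack a' c' y)].

Definition strong_duality (R : realType) (J J' : vectType R) (E : eja J) (E' : eja J')
    (m : nat) (c : J) (a : 'I_m -> J) (c' : J') (a' : 'I_m -> J') (b : 'rV[R]_m)
    (OPT : R) :=
  [/\ ereal_sup [set (jinner E c x.1 + jinner E' c' x.2)%:E |
        x in primal_feasible E E' a a' b] = OPT%:E,
      ereal_inf [set (objective b y)%:E | y in dual_feasible E E' c a c' a'] = OPT%:E &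
      exists2 y, dual_feasible E E' c a c' a' y & objective b y = OPT].

Definition density (R : realType) (J : vectType R) (E : eja J) : set J :=
  [set p | jcone E p /\ jtr E p = 1].

Definition oracle_valid (R : realType) (J J' : vectType R) (E : eja J) (E' : eja J')
    (m : nat) (c : J) (a : 'I_m -> J) (c' : J') (a' : 'I_m -> J') (b : 'rV[R]_m)
    (alpha : R) (p : J) : set 'rV[R]_m :=
  [set y | [/\ 0 <= jinner E (slack a c y) p,
               objective b y <= alpha &
               jcone E' (slack a' c' y)]].

(* [None] is the report of emptiness. *)
Definition is_oracle (R : realType) (J J' : vectType R) (E : eja J) (E' : eja J')
    (m : nat) (c : J) (a : 'I_m -> J) (c' : J') (a' : 'I_m -> J') (b : 'rV[R]_m)
    (alpha : R) (oracle : J -> option 'rV[R]_m) :=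
  forall p, density E p ->
    match oracle p with
    | Some y => oracle_valid E E' c a c' a' b alpha p y
    | None => forall y, ~ oracle_valid E E' c a c' a' b alpha p y
    end.

Definition oracle_width (R : realType) (J : vectType R) (E : eja J) (m : nat)
    (c : J) (a : 'I_m -> J) (oracle : J -> option 'rV[R]_m) (rho : R) :=
  forall p, density E p ->
    forall y, oracle p = Some y -> jnorm_inf E (slack a c y) <= rho.

Definition average (R : realType) (m : nat) (ys : seq 'rV[R]_m) : 'rV[R]_m :=
  (size ys)%:R^-1 *: \sum_(y <- ys) y.

(* The point p^(t+1) determined by ys = [:: y^(1); ...; y^(t)]. *)
Definition next_point (R : realType) (J : vectType R) (E : eja J) (m : nat)
    (c : J) (a : 'I_m -> J) (rho eta : R) (ys : seq 'rV[R]_m) : J :=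
  if ys is [::] then (jrank E)%:R^-1 *: jone E
  else
    let x := jexp E (- (eta * (size ys)%:R / rho) *: slack a c (average ys)) in
    (jtr E x)^-1 *: x.

(* State after [t] iterations: [Some [:: y^(1); ...; y^(t)]], or [None] if the
   oracle has reported emptiness in one of them. *)
Fixpoint meta_run (R : realType) (J : vectType R) (E : eja J) (m : nat)
    (c : J) (a : 'I_m -> J) (rho eta : R) (oracle : J -> option 'rV[R]_m) (t : nat) :
    option (seq 'rV[R]_m) :=
  if t is t'.+1 then
    if meta_run E c a rho eta oracle t' is Some ys then
      if oracle (next_point E c a rho eta ys) is Some y then Some (rcons ys y)
      else None
    else None
  else Some [::].

(* Main.v *)
(* The potential Tr exp(X_t), X_t = -(eta/rho) sum_(s <= t) (slack of y^(s)),
   starts at r and grows by a factor at most exp(eta^2) per iteration; since it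
   dominates exp(lambda_max(X_T)), it bounds the smallest eigenvalue of the
   averaged slack from below by -2 rho eta, which the shift by eps alpha / R
   along a_m = e compensates.

   The step bound avoids the Golden-Thompson inequality. With A = sum x_i p_i,
   B = sum y_j q_j and H = B - A, the traces of exp A, exp A o H, exp A o H^2,
   exp B and exp B o H^2 are all sums over (i, j) of a scalar function of
   (x_i, y_j) with the same weights <p_i, q_j> >= 0, so the scalar inequality
   e^z <= 1 + z + z^2/2 + e^z z^2/4 yields
   Tr exp B <= Tr exp A + Tr(exp A o H) + Tr(exp A o H^2)/2 + Tr(exp B o H^2)/4.

   Spectral decompositions with exactly r idempotents come from the trace form:
   tr(z^2) = <z, z> > 0 forces every nonzero square to have one, and every
   element is a square up to a multiple of e. *)
Require Import Defs.
From HB Require Import structures.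
From mathcomp Require Import all_boot all_order all_algebra.
From mathcomp Require Import all_classical all_reals all_analysis.
From mathcomp.real_closed Require Import complex.
From mathcomp Require Import ring lra.
Import Order.TTheory GRing.Theory Num.Theory numFieldNormedType.Exports.
Local Open Scope classical_set_scope.
Local Open Scope ring_scope.
Set Implicit Arguments.
Unset Strict Implicit.

(** * Real polynomials and a scalar exponential bound *)

Lemma trilinear_polarization (R : realFieldType) (V : zmodType) (t : V -> V -> V -> R) :
  (forall x1 x2 y z, t (x1 + x2) y z = t x1 y z + t x2 y z) ->
  (forall x y1 y2 z, t x (y1 + y2) z = t x y1 z + t x y2 z) ->
  (forall x y z1 z2, t x y (z1 + z2) = t x y z1 + t x y z2) ->
  (forall x, t x x x = 0) ->
  forall x y z,
    t x y z + t x z y + t y x z + t y z x + t z x y + t z y x = 0.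
Proof.
move=> t1 t2 t3 t0 x y z.
(* Inclusion-exclusion: the diagonal value at [x + y + z], minus those at the pairwise sums, plus
   those at single vectors, leaves the six mixed terms. *)
have := t0 (x + y + z); have := t0 (x + y); have := t0 (x + z).
have := t0 (y + z); have := t0 x; have := t0 y; have := t0 z.
rewrite !(t1, t2, t3); lra.
Qed.

(** A complex root [u + iv] yields a linear factor if [v = 0], and the factor [(X - u)^2 + v^2]
    otherwise. The excluded case [v = 0] is a double root, whence [uniq rs]. *)
Lemma split_simple_real_roots (R : rcfType) (f : {poly R}) : f != 0 ->
  (forall u v, ~~ (('X - u%:P) ^+ 2 + (v ^+ 2)%:P %| f)) ->
  exists2 rs : seq R, uniq rs & f %= \prod_(z <- rs) ('X - z%:P).
Proof.
have [n] := ubnP (size f); elim: n => // n IH in f *; rewrite ltnS => szf f0 nq.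
have [sz1|sz1] := eqVneq (size f) 1.
  by exists [::] => //; rewrite big_nil /eqp dvd1p dvdp1 sz1.
have /closed_rootP[[u v] rz] : size (map_poly (real_complex R) f) != 1%N.
  by rewrite size_map_poly.
have [v0|v0] := eqVneq v 0.
  have /factor_theorem[g fE] : root f u.
    by rewrite -(fmorph_root (real_complex R)); rewrite v0 in rz.
  have g0 : g != 0 by apply: contraNneq f0 => g0; rewrite fE g0 mul0r.
  have [||u' v'|rs urs gE] := IH g => //.
  - by apply: leq_trans szf; rewrite fE size_Mmonic ?monicXsubC// size_XsubC addn2.
  - by apply: contra (nq u' v') => /dvdp_mulr; rewrite fE; apply.
  exists (u :: rs); last by rewrite fE big_cons mulrC eqp_mull.
  rewrite /= urs andbT; apply: contra (nq u 0) => urs'.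
  rewrite expr0n addr0 expr2 fE dvdp_mul // (eqp_dvdr _ gE).
  by rewrite (big_rem u) //= dvdp_mulIl.
case/negP: (nq u v); set q := (_ + _).
have szq : size q = 3%N.
  by rewrite size_polyDl size_exp_XsubC // (leq_ltn_trans (size_polyC_leq1 _)).
have q0 : q != 0 by rewrite -size_poly_eq0 szq.
(* The remainder modulo [q] is linear and vanishes at [u + iv]; as [v] is nonzero, the imaginary
   part kills its slope, then the real part its constant term. *)
pose h := f %% q.
have szh : (size h <= 2)%N by rewrite -ltnS -szq ltn_modp.
have hE : h = (h`_1)%:P * 'X + (h`_0)%:P.
  apply/polyP => -[|[|i]]; rewrite coefD coefMX !coefC ?add0r ?addr0 //.
  by rewrite nth_default // (leq_trans szh).
have : root (map_poly (real_complex R) h) (u +i* v)%C.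
  move: rz; rewrite [in X in X -> _](divp_eq f q) -/h rmorphD rmorphM /= !rootE.
  rewrite hornerD hornerM.
  suff -> : (map_poly (real_complex R) q).[(u +i* v)%C] = 0 by rewrite mulr0 add0r.
  rewrite /q rmorphD rmorphXn rmorphB /= map_polyX !map_polyC /= !hornerE /=.
  simpc; rewrite !expr2; simpc; apply/eqP; rewrite eq_complex /=.
  by apply/andP; split; apply/eqP; ring.
rewrite hE rmorphD rmorphM /= map_polyX !map_polyC /= rootE !hornerE /=.
simpc; rewrite eq_complex /= mulf_eq0 (negPf v0) orbF => /andP[+ /eqP h1].
by rewrite h1 mul0r add0r => /eqP h0; rewrite /dvdp -/h hE h1 h0 mul0r addr0.
Qed.

Lemma interpolation (F : fieldType) (rs : seq F) (h : F -> F) : uniq rs ->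
  exists g : {poly F}, {in rs, forall z, g.[z] = h z}.
Proof.
elim: rs => [_|a s IH /andP[as_ us]]; first by exists 0.
have [g gE] := IH us; pose P := \prod_(z <- s) ('X - z%:P).
have Pz z : (P.[z] == 0) = (z \in s) by rewrite -rootE root_prod_XsubC.
exists (g + ((h a - g.[a]) / P.[a]) *: P) => z; rewrite inE hornerD hornerZ.
case/predU1P => [->|zs]; first by rewrite divfK ?Pz // subrKC.
by rewrite gE // (eqP (_ : P.[z] == 0)) ?Pz // mulr0 addr0.
Qed.

(* Unlike [e^z <= 1 + z + z^2], this holds for all [z]: the eigenvalue differences
   it is applied to are not bounded by the norm of the difference. *)
Lemma expR_quad_bound (R : realType) (z : R) :
  expR z <= 1 + z + z ^+ 2 / 2 + expR z * z ^+ 2 / 4.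
Proof.
(* Multiplied by [expR (- z)], the claim reads [1 <= G z]. Since [y * expR (- y) <= 1], the
   derivative [dG] has the sign of its argument, so [G] is minimal at [0]. *)
pose G (x : R) : R := (1 + x + x ^+ 2 / 2) * expR (- x) + x ^+ 2 / 4.
pose dG (x : R) : R := x / 2 * (1 - x * expR (- x)).
have dGE (x : R) : is_derive x 1 G (dG x).
  rewrite /G; apply: is_derive_eq.
  by rewrite /dG /GRing.scale /=; field.
have cG (a b : R) : {within `[a, b], continuous G}.
  apply: continuous_subspaceT => y.
  by apply/differentiable_continuous/derivable1_diffP; have [] := dGE y.
have xe y : y * expR (- y) <= 1.
  rewrite expRN ler_pdivrMr ?expR_gt0 // mul1r.
  by apply: le_trans (expR_ge1Dx y); lra.
have Gge : 1 <= G z.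
  have -> : 1 = G 0 by rewrite /G oppr0 expR0; lra.
  rewrite -subr_ge0; case: (lerP 0 z) => z0.
  - have [c + ->] := MVT_segment z0 (fun y _ => dGE y) (cG 0 z).
    rewrite in_itv /= => /andP[c0 _]; rewrite subr0 mulr_ge0 //.
    by rewrite /dG mulr_ge0 ?subr_ge0 ?xe // divr_ge0.
  - have [c + h] := MVT_segment (ltW z0) (fun y _ => dGE y) (cG z 0).
    rewrite in_itv /= => /andP[_ c0].
    rewrite -opprB h sub0r mulrN opprK mulr_le0 ?(ltW z0) // /dG.
    by rewrite mulr_le0_ge0 ?subr_ge0 ?xe //; lra.
have := ler_wpM2l (expR_ge0 z) Gge.
by rewrite /G mulrDr mulrCA mulrA -mulrA -expRD subrr expR0; lra.
Qed.

Section Eja.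
Context {R : realType} {J : vectType R} (E : eja J).
Local Notation "x '*o' y" := (jmul E x y) (at level 40, left associativity).
Local Notation "''<' x , y '>'" := (jinner E x y) (at level 0, x at level 69, y at level 69).
Local Notation e := (jone E).

(** * Bilinearity *)

Lemma jmulDl x y z : (x + y) *o z = x *o z + y *o z.
Proof. by rewrite -[x]scale1r jmul_linear !scale1r. Qed.

Lemma jmul0l z : 0 *o z = 0.
Proof. by apply: (addrI (0 *o z)); rewrite -jmulDl !addr0. Qed.

Lemma jmulZl k x z : (k *: x) *o z = k *: (x *o z).
Proof. by rewrite -[k *: x]addr0 jmul_linear jmul0l addr0. Qed.

Lemma jmulDr x y z : z *o (x + y) = z *o x + z *o y.
Proof. by rewrite !(jmulC E z) jmulDl. Qed.

Lemma jmulZr k x z : z *o (k *: x) = k *: (z *o x).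
Proof. by rewrite !(jmulC E z) jmulZl. Qed.

Lemma jmul0r z : z *o 0 = 0.
Proof. by rewrite jmulC jmul0l. Qed.

Lemma jmulr1 x : x *o e = x.
Proof. by rewrite jmulC jmul1. Qed.

Lemma jmulNl x z : (- x) *o z = - (x *o z).
Proof. by rewrite -scaleN1r jmulZl scaleN1r. Qed.

Lemma jmulNr x z : z *o (- x) = - (z *o x).
Proof. by rewrite !(jmulC E z) jmulNl. Qed.

Lemma jinnerDl x y z : '<x + y, z> = '<x, z> + '<y, z>.
Proof. by rewrite -[x]scale1r jinner_linear !scale1r mul1r. Qed.

Lemma jinner0l z : '<0, z> = 0.
Proof. by apply: (addrI ('<0, z>)); rewrite -jinnerDl !addr0. Qed.

Lemma jinnerZl k x z : '<k *: x, z> = k * '<x, z>.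
Proof. by rewrite -[k *: x]addr0 jinner_linear jinner0l addr0. Qed.

Lemma jinnerDr x y z : '<z, x + y> = '<z, x> + '<z, y>.
Proof. by rewrite !(jinnerC E z) jinnerDl. Qed.

Lemma jinnerZr k x z : '<z, k *: x> = k * '<z, x>.
Proof. by rewrite !(jinnerC E z) jinnerZl. Qed.

Lemma jinner0r z : '<z, 0> = 0.
Proof. by rewrite jinnerC jinner0l. Qed.

Lemma jinnerNl x z : '<- x, z> = - '<x, z>.
Proof. by rewrite -scaleN1r jinnerZl mulN1r. Qed.

Lemma jinnerNr x z : '<z, - x> = - '<z, x>.
Proof. by rewrite !(jinnerC E z) jinnerNl. Qed.

Lemma jmul_suml I (r : seq I) (P : pred I) (F : I -> J) z :
  (\sum_(i <- r | P i) F i) *o z = \sum_(i <- r | P i) F i *o z.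
Proof.
by apply: (big_morph (fun x => x *o z)) => [x y|]; rewrite ?jmulDl ?jmul0l.
Qed.

Lemma jmul_sumr I (r : seq I) (P : pred I) (F : I -> J) z :
  z *o (\sum_(i <- r | P i) F i) = \sum_(i <- r | P i) z *o F i.
Proof. by rewrite jmulC jmul_suml; apply: eq_bigr => i _; rewrite jmulC. Qed.

Lemma jinner_suml I (r : seq I) (P : pred I) (F : I -> J) z :
  '<\sum_(i <- r | P i) F i, z> = \sum_(i <- r | P i) '<F i, z>.
Proof.
by apply: (big_morph (fun x => '<x, z>)) => [x y|]; rewrite ?jinnerDl ?jinner0l.
Qed.

Lemma jinner_sumr I (r : seq I) (P : pred I) (F : I -> J) z :
  '<z, \sum_(i <- r | P i) F i> = \sum_(i <- r | P i) '<z, F i>.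
Proof. by rewrite jinnerC jinner_suml; apply: eq_bigr => i _; exact: jinnerC. Qed.

Lemma jinner_ge0 x : 0 <= '<x, x>.
Proof. by case: (eqVneq x 0) => [->|/(jinner_gt0 E)/ltW //]; rewrite jinner0l. Qed.

Lemma jinner_eq0 x : '<x, x> = 0 -> x = 0.
Proof. by move=> h; case: (eqVneq x 0) => // /(jinner_gt0 E); rewrite h ltxx. Qed.

Lemma jinner_inj x y : (forall v, '<x, v> = '<y, v>) -> x = y.
Proof.
move=> h; apply/eqP; rewrite -subr_eq0; apply/eqP/jinner_eq0.
by rewrite jinnerDl jinnerNl h subrr.
Qed.

Lemma jinner_sqr z : '<z *o z, e> = '<z, z>.
Proof. by rewrite jinnerA jmulr1. Qed.

(** * Power associativity *)

(* Full polarisation of the Jordan identity, read as an operator identity in [u]. *)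
Lemma jmul3E u w y z :
  (y *o z *o w) *o u = (y *o z) *o (w *o u) + (y *o w) *o (z *o u)
    + (z *o w) *o (y *o u) - y *o (w *o (z *o u)) - z *o (w *o (y *o u)).
Proof.
apply: jinner_inj => v.
pose t (a b c : J) := '<a *o ((b *o c) *o w), v> - '<(b *o c) *o (a *o w), v>.
have t0 x : t x x x = 0 by rewrite /t jmul_jordan subrr.
have t1 x1 x2 y' z' : t (x1 + x2) y' z' = t x1 y' z' + t x2 y' z'.
  by rewrite /t !(jmulDl, jmulDr, jinnerDl); lra.
have t2 x y1 y2 z' : t x (y1 + y2) z' = t x y1 z' + t x y2 z'.
  by rewrite /t !(jmulDl, jmulDr, jinnerDl); lra.
have t3 x y' z1 z2 : t x y' (z1 + z2) = t x y' z1 + t x y' z2.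
  by rewrite /t !(jmulDl, jmulDr, jinnerDl); lra.
have := trilinear_polarization t1 t2 t3 t0 u y z; rewrite /t.
rewrite !(jinnerDl, jinnerNl) !(jmulC E z y) !(jmulC E u y) !(jmulC E u z).
rewrite !(jmulC E u w) !(jmulC E z w) !(jmulC E y w) !(jmulC E u (_ *o _)).
rewrite !(jmulC E w) (jmulC E (z *o u) (y *o w)) (jmulC E (y *o u) (z *o w)); lra.
Qed.

(** Commutation of the multiplication operators of [x] and [y], not of the elements. *)
Definition jcomm x y := forall u, x *o (y *o u) = y *o (x *o u).

Lemma jpowS x n : jpow E x n.+1 = x *o jpow E x n.
Proof. by []. Qed.

(** Two-step induction: [jmul3E] expresses multiplication by [x^(n+2)] through those by [x], [x^2],
    [x^n] and [x^(n+1)]. *)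
Lemma jcomm_jpow_of_sqr x d n : jcomm d x -> jcomm d (x *o x) -> jcomm d (jpow E x n).
Proof.
move=> dx dxx; suff: jcomm d (jpow E x n) /\ jcomm d (jpow E x n.+1) by case.
elim: n => [|n [IH1 IH2]]; first by split=> u; rewrite /jpow /= ?jmulr1 ?jmul1 // dx.
split=> // u.
have F v : jpow E x n.+2 *o v = jpow E x n.+1 *o (x *o v)
   + x *o x *o (jpow E x n *o v) + jpow E x n.+1 *o (x *o v)
   - x *o (x *o (jpow E x n *o v)) - jpow E x n *o (x *o (x *o v)).
  by rewrite jpowS (jmulC E x) {1}jpowS jmul3E (jmulC E (jpow E x n) x).
rewrite /jcomm in dx dxx IH1 IH2.
by rewrite !F !(jmulDr, jmulNr) !(IH1, IH2, dx, dxx).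
Qed.

Lemma jcomm_jpow x n : jcomm x (jpow E x n).
Proof. by apply: jcomm_jpow_of_sqr => u //; rewrite jmul_jordan. Qed.

(** * Evaluation of polynomials at an element *)

Lemma jevalE n (f : {poly R}) x : (size f <= n)%N ->
  jeval E f x = \sum_(i < n) f`_i *: jpow E x i.
Proof.
move=> le_fn; rewrite /jeval (big_ord_widen n (fun i => f`_i *: jpow E x i) le_fn).
rewrite big_mkcond; apply: eq_bigr => i _; case: ltnP => // le_fi.
by rewrite nth_default // scale0r.
Qed.

Lemma jevalD f g x : jeval E (f + g) x = jeval E f x + jeval E g x.
Proof.
rewrite !(@jevalE (maxn (size f) (size g))) ?size_polyD ?leq_maxl ?leq_maxr //.
rewrite -big_split.
by apply: eq_bigr => i _; rewrite coefD scalerDl.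
Qed.

Lemma jevalZ k f x : jeval E (k *: f) x = k *: jeval E f x.
Proof.
rewrite !(@jevalE (size f)) ?size_scale_leq // scaler_sumr.
by apply: eq_bigr => i _; rewrite coefZ scalerA.
Qed.

Lemma jevalC k x : jeval E k%:P x = k *: e.
Proof. by rewrite (@jevalE 1) ?size_polyC_leq1 // big_ord1 coefC. Qed.

Lemma jevalMX f x : jeval E (f * 'X) x = x *o jeval E f x.
Proof.
rewrite (@jevalE (size f).+1); last first.
  by apply: leq_trans (size_polyMleq _ _) _; rewrite size_polyX addn2.
rewrite big_ord_recl coefMX scale0r add0r jmul_sumr.
by apply: eq_bigr => i _; rewrite coefMX /= jmulZr.
Qed.

Lemma jcomm_jeval f x : jcomm x (jeval E f x).
Proof.
move=> u; rewrite /jeval !jmul_suml jmul_sumr.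
by apply: eq_bigr => i _; rewrite !jmulZl jmulZr jcomm_jpow.
Qed.

(** Power associativity: in the induction on [f], operator commutation of [x] with the value of [g]
    replaces associativity. *)
Lemma jevalM f g x : jeval E (f * g) x = jeval E f x *o jeval E g x.
Proof.
elim/poly_ind: f => [|f k IH].
  by rewrite mul0r -(scale0r 0) jevalZ scale0r jmul0l.
rewrite mulrDl -mulrA (mulrC 'X) mulrA mul_polyC !jevalD !jevalMX jevalZ jevalC.
by rewrite jmulDl jmulZl jmul1 IH (jmulC E (x *o _)) -jcomm_jeval (jmulC E _ (jeval E f x)).
Qed.

Lemma jevalX x : jeval E 'X x = x.
Proof. by rewrite -['X]mul1r jevalMX -polyC1 jevalC scale1r jmulr1. Qed.

Lemma jeval_annihilator x : exists2 f : {poly R}, f != 0 & jeval E f x = 0.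
Proof.
pose n := (\dim (fullv : {vspace J})).+1.
pose X := [tuple jpow E x i | i < n].
have : ~~ free X.
  apply/negP => frX; have := dimvS (subvf <<X>>).
  by rewrite (eqP frX) size_tuple ltnn.
move/freeP/existsNP=> [k /not_implyP[Xk0 /existsNP[i /eqP ki]]].
pose f := \poly_(i < n) (if insub i is Some j then k j else 0).
have fk (j : 'I_n) : f`_j = k j by rewrite coef_poly ltn_ord valK.
exists f; first by apply: contraNneq ki => f0; rewrite -fk f0 coef0.
rewrite (jevalE x (size_poly _ _)) -[RHS]Xk0.
by apply: eq_bigr => j _; rewrite fk (nth_map j) ?size_enum_ord // nth_ord_enum.
Qed.

(** Positivity of the inner product forces the minimal annihilator to have simple real roots. A
    polynomial interpolating the square root of [z + N] at these roots squares to [X + N] modulo the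
    annihilator. *)
Lemma shift_is_sqr x : exists N z, x + N *: e = z *o z.
Proof.
pose ann n := `[< exists2 f : {poly R}, f != 0 & jeval E f x = 0 /\ size f = n >].
have /ex_minnP[n /asboolP[f f0 [fx szf]] nmin] : exists n, ann n.
  by have [f f0 fx] := jeval_annihilator x; exists (size f); apply/asboolP; exists f.
have minf g : jeval E g x = 0 -> (size g < size f)%N -> g = 0.
  move=> gx; apply: contraTeq => g0; rewrite -leqNgt szf; apply: nmin.
  by apply/asboolP; exists g.
(* A factor [(X - u)^2 + v^2] of the minimal annihilator [f] would give, with
   its cofactor [g], two elements [y], [z] with [y^2 + z^2 = 0]. *)
have [|rs urs fE] := split_simple_real_roots f0.
  move=> u v; apply/negP; set q := (_ + _) => /dvdpP[g fE].
  have g0 : g != 0 by apply: contraNneq f0 => g0; rewrite fE g0 mul0r.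
  have szq : size q = 3%N.
    by rewrite size_polyDl size_exp_XsubC // (leq_ltn_trans (size_polyC_leq1 _)).
  have szfE : size f = (size g).+2 by rewrite fE size_mul // ?szq ?addn3 // -size_poly_eq0 szq.
  pose y := jeval E (('X - u%:P) * g) x; pose z := jeval E (v%:P * g) x.
  have yz : y *o y + z *o z = 0.
    have -> : y *o y + z *o z = jeval E (f * g) x.
      rewrite -!jevalM -jevalD fE /q polyC_exp; congr (jeval E _ x); ring.
    by rewrite jevalM fx jmul0l.
  have yz' : '<y, y> + '<z, z> = 0 by rewrite -!jinner_sqr -jinnerDl yz jinner0l.
  have y0 : y = 0 by apply: jinner_eq0; have := jinner_ge0 y; have := jinner_ge0 z; lra.
  (* [(X - u) * g] annihilates [x] and is smaller than [f], so [g = 0]. *)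
  have := minf _ y0; rewrite mulrC size_Mmonic ?monicXsubC // size_XsubC addn2 /=.
  rewrite szfE => /(_ (ltnSn _)).
  by move/eqP; rewrite mulf_eq0 (negPf g0) polyXsubC_eq0.
pose N := \sum_(z <- rs) `|z|.
have rN z : z \in rs -> 0 <= z + N.
  move=> zrs; rewrite /N (big_rem z) //= addrA addr_ge0 ?sumr_ge0 //.
  by rewrite -lerBlDl sub0r -normrN ler_norm.
have [g gE] := interpolation (fun z => Num.sqrt (z + N)) urs.
exists N, (jeval E g x).
have : f %| g * g - ('X + N%:P).
  rewrite (eqp_dvdl _ fE) uniq_roots_dvdp ?uniq_rootsE //.
  apply/allP => z zrs; rewrite rootE !hornerE gE // -expr2 sqr_sqrtr ?rN //.
  by rewrite subrr.
case/dvdpP=> k /(canRL (subrK _)) kE; rewrite -jevalM kE !jevalD jevalM fx jmul0r.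
by rewrite jevalX jevalC add0r.
Qed.

(** * Spectral decompositions and self-duality of the cone *)

Lemma jordan_frame_mul n (p : 'I_n -> J) (a b : 'I_n -> R) :
  jordan_frame E p ->
  (\sum_i a i *: p i) *o (\sum_i b i *: p i) = \sum_i (a i * b i) *: p i.
Proof.
move=> [pI pO _]; rewrite jmul_suml; apply: eq_bigr => i _.
rewrite jmul_sumr (bigD1 i) //= big1 => [|j ji].
  by rewrite jmulZl jmulZr scalerA addr0; have [_ -> _] := pI i.
by rewrite jmulZl jmulZr pO ?scaler0 // eq_sym.
Qed.

Lemma jordan_frame_scale n (p : 'I_n -> J) k :
  jordan_frame E p -> k *: e = \sum_i k *: p i.
Proof. by case=> _ _ pE; rewrite -scaler_sumr pE. Qed.

Lemma jordan_frame_inner n (p : 'I_n -> J) i :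
  jordan_frame E p -> '<p i, p i> = '<p i, e>.
Proof. by case=> pI _ _; rewrite -jinner_sqr; have [_ -> _] := pI i. Qed.

Lemma jordan_frame_coord n (p : 'I_n -> J) (a : 'I_n -> R) i :
  jordan_frame E p -> '<\sum_i a i *: p i, p i> = a i * '<p i, p i>.
Proof.
move=> [pI pO _]; rewrite jinner_suml (bigD1 i) //= big1 => [|j ji].
  by rewrite addr0 jinnerZl.
have [_ pii _] := pI i.
by rewrite jinnerZl -[in X in _ * X]pii -jinnerA pO // jinner0l mulr0.
Qed.

Lemma jordan_frame_gt0 n (p : 'I_n -> J) i : jordan_frame E p -> 0 < '<p i, p i>.
Proof. by case=> pI _ _; apply: jinner_gt0; have [] := pI i. Qed.

(* On the Peirce eigenvalues [0], [1/2], [1] of [L = jmul q] one has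
   [L = L^2 + 4 (L - L^2)^2]. *)
Lemma jmul_idempotent_psd q z : Defs.idempotent E q -> 0 <= '<z, q *o z>.
Proof.
(* The polarised Jordan identity at [q, q, q] is the Peirce cubic [L = 3 L^2 - 2 L^3]. *)
move=> qq; have L3 v : q *o v = 3 *: (q *o (q *o v)) - 2 *: (q *o (q *o (q *o v))).
  have := jmul3E v q q q; rewrite !qq => {1}->.
  by rewrite !scaler_nat !mulrS !mulr0n !addr0 opprD !addrA.
have sym u v : '<u, q *o v> = '<q *o u, v> by rewrite -jinnerA (jmulC E u).
have -> : '<z, q *o z> = '<q *o z, q *o z>
    + 4 * '<q *o z - q *o (q *o z), q *o z - q *o (q *o z)>.
  have h1 := congr1 (fun v => '<z, v>) (L3 z).
  have h2 := congr1 (fun v => '<q *o z, v>) (L3 z).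
  rewrite /= !(jinnerDl, jinnerDr, jinnerNl, jinnerNr, jinnerZr) in h1 h2 *.
  rewrite !sym in h1 h2 *.
  by rewrite ?(jinnerC E (q *o (q *o z)) (q *o z)) in h1 h2 *; lra.
by rewrite addr_ge0 ?mulr_ge0 ?jinner_ge0.
Qed.

Lemma jcone_idempotent q : Defs.idempotent E q -> jcone E q.
Proof. by move=> qq; exists q. Qed.

Lemma jcone_inner_idempotent x q :
  jcone E x -> Defs.idempotent E q -> 0 <= '<x, q>.
Proof. by move=> [z ->] qq; rewrite jinnerA (jmulC E z) jmul_idempotent_psd. Qed.

Lemma is_spectral_jcone n x (d : {ffun 'I_n -> R} * {ffun 'I_n -> J}) :
  is_spectral E x d -> jcone E x <-> forall i, 0 <= d.1 i.
Proof.
case=> fr ->; split=> [Kx i|d0].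
  have [pI _ _] := fr; have [_ pi _] := pI i.
  have := jcone_inner_idempotent Kx pi.
  by rewrite (jordan_frame_coord _ _ fr) pmulr_lge0 // jordan_frame_gt0.
exists (\sum_i Num.sqrt (d.1 i) *: d.2 i); rewrite jordan_frame_mul //.
by apply: eq_bigr => i _; rewrite -expr2 sqr_sqrtr.
Qed.

Lemma jcone0 : jcone E 0.
Proof. by exists 0; rewrite jmul0l. Qed.

Lemma jconeZ k x : 0 <= k -> jcone E x -> jcone E (k *: x).
Proof.
move=> k0 [z ->]; exists (Num.sqrt k *: z).
by rewrite jmulZl jmulZr scalerA -expr2 sqr_sqrtr.
Qed.

Section TraceForm.
Context (hE : trace_form E).

Lemma jtrE x : jtr E x = '<x, e>.
Proof. by rewrite hE jmulr1. Qed.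

Lemma sqr_spectral z : z != 0 -> is_spectral E (z *o z) (spectral E (z *o z)).
Proof.
move=> z0; have := jinner_gt0 E z0; rewrite hE /jtr /spectral.
case: xgetP => // none; rewrite big1 ?ltxx // => i _.
by rewrite ffunE.
Qed.

(* A nonzero square has positive trace, which the junk value of [spectral] has
   not; every element is a square up to a multiple of the unit. *)
Lemma spectralP x : e != 0 -> is_spectral E x (spectral E x).
Proof.
move=> e0; suff [d dx] : exists d : {ffun 'I_(jrank E) -> R} * {ffun 'I_(jrank E) -> J}, is_spectral E x d
  by apply: (xgetPex _ (P := [set d | is_spectral E x d])); exists d.
have [N [z xN]] := shift_is_sqr x.
have {xN} xE : x = z *o z - N *: e by rewrite -xN addrK.
have [z0|/sqr_spectral[fr sE]] := eqVneq z 0.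
  (* A frame is still needed when [z = 0]; the square of [e] supplies one. *)
  have [fr _] := sqr_spectral e0.
  exists ([ffun=> - N], (spectral E (e *o e)).2); split=> //=.
  rewrite xE z0 jmul0l add0r -scaleNr (jordan_frame_scale _ fr).
  by apply: eq_bigr => i _; rewrite ffunE.
exists ([ffun i => (spectral E (z *o z)).1 i - N], (spectral E (z *o z)).2).
split=> //=; rewrite xE {1}sE (jordan_frame_scale _ fr) -sumrB.
by apply: eq_bigr => i _; rewrite ffunE scalerBl.
Qed.

(** A square is a nonnegative combination of idempotents, each of which pairs nonnegatively with
    [x]. *)
Lemma jcone_inner_ge0 x y : jcone E x -> jcone E y -> 0 <= '<x, y>.
Proof.
move=> Kx [z ->]; have [->|z0] := eqVneq z 0; first by rewrite jmul0l jinner0r.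
have sp := sqr_spectral z0; have [fr ->] := sp.
have d0 := (is_spectral_jcone sp).1 (ex_intro _ z erefl).
rewrite jinner_sumr sumr_ge0 // => i _; rewrite jinnerZr mulr_ge0 //.
by apply: jcone_inner_idempotent => //; have [pI _ _] := fr; have [] := pI i.
Qed.

(** Each eigenvalue of the sum has the sign of a pairing with an idempotent, and such pairings are
    additive. *)
Lemma jconeD x y : jcone E x -> jcone E y -> jcone E (x + y).
Proof.
move=> Kx Ky; have [e0|e0] := eqVneq e 0.
  by rewrite -[x + y](jmul1 E) e0 jmul0l; exact: jcone0.
have sp := spectralP (x + y) e0; have [fr sE] := sp.
apply/(is_spectral_jcone sp) => i; have [pI _ _] := fr; have [_ pi _] := pI i.
have := jcone_inner_idempotent Kx pi; have := jcone_inner_idempotent Ky pi.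
move=> h1 h2; have := addr_ge0 h2 h1; rewrite -jinnerDl {1}sE.
by rewrite (jordan_frame_coord _ _ fr) pmulr_lge0 // jordan_frame_gt0.
Qed.

Lemma jcone_sum I (r : seq I) (P : pred I) (F : I -> J) :
  (forall i, P i -> jcone E (F i)) -> jcone E (\sum_(i <- r | P i) F i).
Proof. by move=> KF; apply: big_ind => //; [exact: jcone0|exact: jconeD]. Qed.

(* The eigenvalues of an idempotent are [0] and [1], so its trace is a positive
   integer. *)
Lemma jtr_idempotent_ge1 q : q != 0 -> Defs.idempotent E q -> 1 <= '<q, e>.
Proof.
move=> q0 qq; have sp : is_spectral E q (spectral E q) by rewrite -qq; exact: sqr_spectral.
have [fr sE] := sp; set d := spectral E q in sp fr sE.
have dd i : d.1 i = 0 \/ d.1 i = 1.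
  have := congr1 (fun v => '<v, d.2 i>) qq; rewrite {1 2 3}sE jordan_frame_mul //.
  rewrite !(jordan_frame_coord _ _ fr).
  move/(mulIf (lt0r_neq0 (jordan_frame_gt0 i fr))) => h.
  have : d.1 i * (d.1 i - 1) = 0 by rewrite mulrBr h mulr1 subrr.
  by move/eqP; rewrite mulf_eq0 subr_eq0 => /orP[]/eqP; [left|right].
have d0 i : 0 <= d.1 i by case: (dd i) => ->.
have : 0 < jtr E q by rewrite jtrE -qq jinner_sqr jinner_gt0.
rewrite -jtrE /jtr -/d => tr0.
have [i di] : exists i, d.1 i != 0.
  apply/existsP; apply: contraTT tr0; rewrite negb_exists => /forallP h.
  by rewrite big1 ?ltxx // => i _; have /negPn/eqP := h i.
rewrite (bigD1 i) //= ler_wpDr ?sumr_ge0 //.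
by case: (dd i) di => -> //; rewrite eqxx.
Qed.

Lemma jtr_one : e != 0 -> '<e, e> = (jrank E)%:R.
Proof.
move=> e0; have [fr sE] := spectralP e e0; set d := spectral E e in fr sE.
rewrite -jtrE /jtr -/d -[RHS]mulr1 mulr_natl -[X in _ *+ X]card_ord -sumr_const.
apply: eq_bigr => i _; apply: (mulIf (lt0r_neq0 (jordan_frame_gt0 i fr))).
by rewrite -(jordan_frame_coord _ _ fr) -sE mul1r jinnerC (jordan_frame_inner _ fr).
Qed.

(** * The exponential trace inequality *)

Lemma jinner_pair n k (p : 'I_n -> J) (q : 'I_k -> J) (a : 'I_n -> R) (b : 'I_k -> R) :
  '<\sum_i a i *: p i, \sum_j b j *: q j>
    = \sum_i \sum_j a i * b j * '<p i, q j>.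
Proof.
rewrite jinner_suml; apply: eq_bigr => i _; rewrite jinner_sumr.
by apply: eq_bigr => j _; rewrite jinnerZl jinnerZr mulrA.
Qed.

(** Associativity moves [A] onto [G], with which it shares a frame, so each term of the expanded
    square pairs the two frames. *)
Lemma jinner_sqr_diff n k (p : 'I_n -> J) (q : 'I_k -> J)
    (g x : 'I_n -> R) (y : 'I_k -> R) :
  jordan_frame E p -> jordan_frame E q ->
  let H := \sum_j y j *: q j - \sum_i x i *: p i in
  '<\sum_i g i *: p i, H *o H>
    = \sum_i \sum_j g i * (y j - x i) ^+ 2 * '<p i, q j>.
Proof.
move=> fp fq; set A := \sum_i x i *: p i; set B := \sum_j y j *: q j.
set G := \sum_i g i *: p i => /=.
have eE : e = \sum_j 1 *: q j by rewrite -(jordan_frame_scale _ fq) scale1r.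
have -> : '<G, (B - A) *o (B - A)> =
    '<G, B *o B> - '<G *o A, B> - '<G *o A, B> + '<G *o (A *o A), e>.
  rewrite !(jinnerA, jmulr1) !(jmulDl, jmulDr, jmulNl, jmulNr) (jmulC E B A).
  by rewrite !(jinnerDr, jinnerNr); ring.
rewrite !jordan_frame_mul // eE !jinner_pair -!sumrN -!big_split /=.
apply: eq_bigr => i _; rewrite -!sumrN -!big_split /=.
by apply: eq_bigr => j _; ring.
Qed.

(* Klein's inequality: every trace below is a sum over pairs of eigenvalues
   [x i], [y j] with the same nonnegative weights ['<p i, q j>]. *)
Lemma trace_exp_le n k (p : 'I_n -> J) (q : 'I_k -> J) (x : 'I_n -> R) (y : 'I_k -> R) :
  jordan_frame E p -> jordan_frame E q ->
  let H := \sum_j y j *: q j - \sum_i x i *: p i in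
  let eA := \sum_i expR (x i) *: p i in
  let eB := \sum_j expR (y j) *: q j in
  '<eB, e> <= '<eA, e> + '<eA, H> + '<eA, H *o H> / 2 + '<eB, H *o H> / 4.
Proof.
move=> fp fq /=; set A := \sum_i x i *: p i; set B := \sum_j y j *: q j.
set eA := \sum_i expR (x i) *: p i; set eB := \sum_j expR (y j) *: q j.
have eE : e = \sum_j 1 *: q j by rewrite -(jordan_frame_scale _ fq) scale1r.
have eE' : e = \sum_i 1 *: p i by rewrite -(jordan_frame_scale _ fp) scale1r.
have -> : '<eB, (B - A) *o (B - A)>
    = \sum_i \sum_j expR (y j) * (y j - x i) ^+ 2 * '<p i, q j>.
  have -> : (B - A) *o (B - A) = (A - B) *o (A - B).
    by rewrite -(opprB A B) jmulNl jmulNr opprK.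
  rewrite jinner_sqr_diff // exchange_big; apply: eq_bigr => i _ /=.
  by apply: eq_bigr => j _; rewrite (jinnerC E (q _)) -sqrrN opprB.
rewrite jinner_sqr_diff // jinnerDr jinnerNr.
have -> : '<eA, A> = '<eA *o A, e> by rewrite jinnerA jmulr1.
rewrite jordan_frame_mul // (jinnerC E eB) {1}eE' eE !jinner_pair.
rewrite -!sumrN !mulr_suml -!big_split /=; apply: ler_sum => i _.
rewrite -!sumrN !mulr_suml -!big_split /=; apply: ler_sum => j _.
have w0 : 0 <= '<p i, q j>.
  have [[_ pI _] [_ qI _]] : primitive_idempotent E (p i) /\ primitive_idempotent E (q j).
    by split; [case: fp | case: fq].
  by apply: jcone_inner_idempotent => //; exact: jcone_idempotent.
(* The factor [expR (x i)] turns [expR (y j - x i)] into [expR (y j)]. *)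
have h := ler_wpM2l (expR_ge0 (x i)) (expR_quad_bound (y j - x i)).
rewrite -expRD addrC subrK in h.
rewrite -subr_ge0; apply: le_trans (mulr_ge0 w0 (_ : 0 <= expR (x i) *
  (1 + (y j - x i) + (y j - x i) ^+ 2 / 2 + expR (y j - x i) * (y j - x i) ^+ 2 / 4)
   - expR (y j))) _; first by rewrite subr_ge0.
rewrite !mulrDr [expR (x i) * (expR _ * _ / _)]mulrA [expR (x i) * (expR _ * _)]mulrA.
rewrite -expRD [x i + _]addrC subrK; lra.
Qed.

Context (e0 : e != 0).

Lemma jcone_jexp x : jcone E (jexp E x).
Proof.
have [[fI _ _] _] := spectralP x e0.
apply: jcone_sum => i _; apply: jconeZ; first exact: expR_ge0.
by apply: jcone_idempotent; case: (fI i).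
Qed.

(** Every frame idempotent has trace at least 1, so a single term already bounds the trace from
    below. *)
Lemma jexp_eigen_le x i : expR ((spectral E x).1 i) <= jtr E (jexp E x).
Proof.
have [[fI _ _] _] := spectralP x e0.
have q1 j : 1 <= '<(spectral E x).2 j, e>.
  by case: (fI j) => q0 qq _; apply: jtr_idempotent_ge1.
rewrite jtrE jinner_suml (bigD1 i) //= jinnerZl ler_wpDr ?sumr_ge0 // => [j _|].
  by rewrite jinnerZl mulr_ge0 ?expR_ge0 // (le_trans _ (q1 j)).
by rewrite ler_peMr ?expR_ge0.
Qed.

Lemma jrank_gt0 : (0 < jrank E)%N.
Proof. by rewrite -(ltr0n R) -jtr_one // jinner_gt0. Qed.

Lemma jtr_jexp_gt0 x : 0 < jtr E (jexp E x).
Proof. exact: lt_le_trans (expR_gt0 _) (jexp_eigen_le x (Ordinal jrank_gt0)). Qed.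

Lemma jexp0 : jexp E 0 = e.
Proof.
have [fr sE] := spectralP 0 e0; rewrite /jexp; have [_ _ <-] := fr.
apply: eq_bigr => i _; suff -> : (spectral E 0).1 i = 0 by rewrite expR0 scale1r.
apply: (mulIf (lt0r_neq0 (jordan_frame_gt0 i fr))).
by rewrite -(jordan_frame_coord _ _ fr) -sE jinner0l mul0r.
Qed.

(** The linear term of [trace_exp_le] is dropped, and the cone hypothesis bounds the quadratic terms
    by [k] times the traces; the one in [exp B] is absorbed on the left. *)
Lemma jtr_jexp_step A B k : k <= 1 -> '<jexp E A, B - A> <= 0 ->
  jcone E (k *: e - (B - A) *o (B - A)) ->
  jtr E (jexp E B) <= jtr E (jexp E A) * expR k.
Proof.
move=> k1 AH KH; set H := (B - A) in AH KH.
have sq x : '<jexp E x, H *o H> <= k * jtr E (jexp E x).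
  have := jcone_inner_ge0 (jcone_jexp x) KH.
  by rewrite jinnerDr jinnerNr jinnerZr -jtrE subr_ge0.
have k0 : 0 <= k.
  have : 0 <= '<jexp E A, H *o H>.
    by apply: jcone_inner_ge0; [exact: jcone_jexp|exists H].
  by move=> /le_trans /(_ (sq A)); rewrite pmulr_lge0 // jtr_jexp_gt0.
have := sq A; have := sq B; have [frA AE] := spectralP A e0.
have [frB BE] := spectralP B e0.
have := trace_exp_le (spectral E A).1 (spectral E B).1 frA frB => /=.
rewrite -AE -BE -/(jexp E A) -/(jexp E B) -/H -!jtrE.
have := jtr_jexp_gt0 A; set a := jtr E (jexp E A); set b := jtr E (jexp E B).
move=> a0 h1 h2 h3.
have h4 : b * (1 - k / 4) <= a * (1 + k / 2) by lra.
(* Since [expR k >= 1 + k], this rests on [(1 + k)(1 - k/4) - (1 + k/2) = k(1 - k)/4]. *)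
have h5 : a * (1 + k / 2) <= a * expR k * (1 - k / 4).
  rewrite -mulrA ler_wpM2l ?(ltW a0) //.
  have k4 : 0 <= 1 - k / 4 by lra.
  have := ler_wpM2r k4 (expR_ge1Dx k).
  have : 0 <= k * (1 - k) by rewrite mulr_ge0 ?subr_ge0.
  lra.
by have := le_trans h4 h5; rewrite ler_pM2r //; lra.
Qed.

Lemma jnorm_inf_sqr x rho : jnorm_inf E x <= rho ->
  jcone E (rho ^+ 2 *: e - x *o x).
Proof.
move=> xr; have [fr sE] := spectralP x e0; have [fI _ _] := fr.
rewrite sE jordan_frame_mul // (jordan_frame_scale _ fr) -sumrB.
apply: jcone_sum => i _; rewrite -scalerBl; apply: jconeZ; last first.
  by apply: jcone_idempotent; case: (fI i).
have := le_trans (le_bigmax _ (fun i => `|(spectral E x).1 i|) i) xr.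
by rewrite ler_norml => /andP[]; nra.
Qed.

Lemma jnorm_inf_shift x rho : jnorm_inf E x <= rho -> jcone E (x + rho *: e).
Proof.
move=> xr; have [fr sE] := spectralP x e0; have [fI _ _] := fr.
rewrite [X in X + _]sE (jordan_frame_scale _ fr) -big_split.
apply: jcone_sum => i _ /=; rewrite -scalerDl; apply: jconeZ; last first.
  by apply: jcone_idempotent; case: (fI i).
have := le_trans (le_bigmax _ (fun i => `|(spectral E x).1 i|) i) xr.
by rewrite ler_norml => /andP[]; lra.
Qed.

End TraceForm.
End Eja.

(** * The meta-algorithm *)

Lemma slack_shift (R : realType) (J : vectType R) m (a : 'I_m.+1 -> J) c
    (y : 'rV[R]_m.+1) (d : R) :
  slack a c (\row_j (y 0 j + if j == ord_max then d else 0))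
    = slack a c y + d *: a ord_max.
Proof.
rewrite /slack addrAC; congr (_ - c).
under eq_bigr do rewrite mxE scalerDl.
rewrite big_split /=; congr (_ + _).
rewrite (bigD1 ord_max) //= eqxx big1 ?addr0 // => j /negPf ->.
by rewrite scale0r.
Qed.

Lemma objective_shift (R : realType) m (b y : 'rV[R]_m.+1) (d : R) :
  objective b (\row_j (y 0 j + if j == ord_max then d else 0))
    = objective b y + b 0 ord_max * d.
Proof.
rewrite /objective; under eq_bigr do rewrite mxE mulrDr.
rewrite big_split /=; congr (_ + _).
rewrite (bigD1 ord_max) //= eqxx big1 ?addr0 // => j /negPf ->.
by rewrite mulr0.
Qed.

Lemma average_coord (R : realType) m (ys : seq 'rV[R]_m) j :
  average ys 0 j = (size ys)%:R^-1 * \sum_(y <- ys) y 0 j.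
Proof. by rewrite /average mxE summxE. Qed.

Lemma slack_average (R : realType) (J : vectType R) m (a : 'I_m -> J) c
    (ys : seq 'rV[R]_m) : ys != [::] ->
  slack a c (average ys) = (size ys)%:R^-1 *: \sum_(y <- ys) slack a c y.
Proof.
move=> ys0; rewrite /slack sumrB scalerBr big_const_seq count_predT iter_addr_0.
rewrite -(scaler_nat _ c) scalerA mulVf ?pnatr_eq0 ?size_eq0 // scale1r; congr (_ - c).
rewrite exchange_big scaler_sumr; apply: eq_bigr => j _ /=.
by rewrite average_coord -scaler_suml scalerA.
Qed.

Lemma objective_average (R : realType) m (b : 'rV[R]_m) (ys : seq 'rV[R]_m) :
  objective b (average ys) = (size ys)%:R^-1 * \sum_(y <- ys) objective b y.
Proof.
rewrite /objective exchange_big mulr_sumr; apply: eq_bigr => j _ /=.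
by rewrite average_coord mulrCA mulr_sumr.
Qed.

Lemma objective_average_le (R : realType) m (b : 'rV[R]_m) (ys : seq 'rV[R]_m) alpha :
  ys != [::] -> {in ys, forall y, objective b y <= alpha} ->
  objective b (average ys) <= alpha.
Proof.
move=> ys0 bys; rewrite objective_average ler_pdivrMl; last first.
  by rewrite ltr0n lt0n size_eq0.
rewrite mulr_natl.
apply: (@le_trans _ _ (\sum_(y <- ys) alpha)).
  by rewrite big_seq [leRHS]big_seq; exact: ler_sum.
by rewrite big_const_seq count_predT iter_addr_0.
Qed.

(** If [e = 0], the constant polynomial 1 annihilates everything, so minimal polynomials have degree
    0; the default of [xget] agrees. *)
Lemma jone_eq0_rank (R : realType) (J : vectType R) (E : eja J) :
  jone E = 0 -> jrank E = 0%N.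
Proof.
move=> e0; rewrite /jrank; case: xgetP => // r _ [[x [f [fm <-]]] _].
have [_ _ /(_ 1)] := fm; rewrite oner_neq0 size_poly1 => /(_ isT) h.
apply/eqP; rewrite -leqn0 -ltnS; case: (size f) h => // n; apply.
by rewrite -[LHS](jmul1 E) e0 jmul0l.
Qed.

(** * Invariants of a run *)

Section Run.
Context {R : realType} {J J' : vectType R} {E : eja J} {E' : eja J'}.
Context (hE : trace_form E) (e0 : jone E != 0).
Context {m : nat} {c : J} {a : 'I_m.+1 -> J} {c' : J'} {a' : 'I_m.+1 -> J'}.
Context {b : 'rV[R]_m.+1} {alpha rho eta : R} {oracle : J -> option 'rV[R]_m.+1}.
Context (rho0 : 0 < rho).
Context (horacle : is_oracle E E' c a c' a' b alpha oracle).
Context (hwidth : oracle_width E c a oracle rho).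

Local Notation expo ys := (- (eta / rho) *: \sum_(y <- ys) slack a c y).
Local Notation run := (meta_run E c a rho eta oracle).
Local Notation next := (next_point E c a rho eta).

(** One formula covers the start as well: the empty sum has exponential [e], of trace [r]. *)
Lemma next_pointE ys :
  next ys = (jtr E (jexp E (expo ys)))^-1 *: jexp E (expo ys).
Proof.
case: (eqVneq ys [::]) => [->|ys0].
  by rewrite big_nil scaler0 jexp0 // jtrE // jtr_one.
have -> : expo ys = - (eta * (size ys)%:R / rho) *: slack a c (average ys).
  rewrite slack_average // scalerA; congr (_ *: _).
  by field; rewrite pnatr_eq0 size_eq0 ys0 gt_eqF.
by case: ys ys0.
Qed.

Lemma next_density ys : density E (next ys).
Proof.
rewrite next_pointE; have h := jtr_jexp_gt0 hE e0 (expo ys); split.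
  by apply: jconeZ (jcone_jexp hE e0 _); rewrite invr_ge0 ltW.
by rewrite jtrE // jinnerZl -jtrE // mulVf // gt_eqF.
Qed.

Lemma run_None t : run t = None -> exists ys, oracle (next ys) = None.
Proof.
elim: t => // t IH /=; case: (run t) IH => [ys _|IH _]; last exact: IH.
by case o: (oracle _) => // _; exists ys.
Qed.

Lemma run_valid t ys : run t = Some ys ->
  size ys = t /\ {in ys, forall y, [/\ objective b y <= alpha,
    jcone E' (slack a' c' y) & jnorm_inf E (slack a c y) <= rho]}.
Proof.
elim: t ys => [_ [<-]|t IH ys] //=.
case: (run t) IH => // zs /(_ _ erefl)[sz Hzs].
case o: (oracle _) => [y|] // [<-]; split; first by rewrite size_rcons sz.
move=> z; rewrite mem_rcons inE => /predU1P[->|/Hzs //].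
have := horacle (next_density zs); rewrite o => -[_ h1 h2]; split=> //.
exact: hwidth (next_density zs) _ o.
Qed.

(** Each iteration applies [jtr_jexp_step] with [k = eta^2]. The query is a positive multiple of the
    exponential, so the oracle inequality signs the linear term; the width bounds the squared
    increment by [eta^2 e]. *)
Lemma run_potential t ys : 0 <= eta -> eta <= 1 -> run t = Some ys ->
  jtr E (jexp E (expo ys)) <= (jrank E)%:R * expR (eta ^+ 2 *+ t).
Proof.
move=> eta0 eta1; elim: t ys => [_ [<-]|t IH ys /=].
  by rewrite big_nil scaler0 jexp0 // jtrE // jtr_one // mulr0n expR0 mulr1.
case: (run t) IH => // zs /(_ _ erefl) Hzs.
case o: (oracle _) => [y|] // [<-].
have := horacle (next_density zs); rewrite o => -[h0 _ _].
have hr := hwidth (next_density zs) o.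
rewrite mulrSr expRD mulrA; apply: le_trans (ler_wpM2r (expR_ge0 _) Hzs).
have dE : expo (rcons zs y) - expo zs = - (eta / rho) *: slack a c y.
  by rewrite big_rcons /= scalerDr addrAC subrr add0r.
apply: (jtr_jexp_step hE e0); rewrite ?dE.
- by rewrite expr_le1.
- move: h0; rewrite next_pointE jinnerZr pmulr_rge0 ?invr_gt0 ?jtr_jexp_gt0 // jinnerC.
  move=> h0; rewrite jinnerZr mulNr oppr_le0 mulr_ge0 // divr_ge0 // ltW //.
- have := jconeZ (sqr_ge0 (eta / rho)) (jnorm_inf_sqr hE e0 hr).
  rewrite scalerBr scalerA -exprMn divfK ?gt_eqF //.
  by rewrite jmulZl jmulZr scalerA mulrNN -expr2.
Qed.

(** For [eta <= 1], the choice of [eta] makes the potential bound equal to [expR (2 eta^2 t)], so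
    eigenvalues of the exponent are at most [2 eta^2 t]. Rescaling by [- rho / (eta t)] bounds those
    of the averaged slack below by [- 2 rho eta]. *)
Lemma run_slack t ys d : run t = Some ys -> (0 < t)%N -> 0 < eta ->
  eta ^+ 2 * t%:R = ln (jrank E)%:R -> 2 * rho * eta <= d ->
  jcone E (slack a c (average ys) + d *: jone E).
Proof.
move=> hrun t0 eta0 etaE hd; have [sz hys] := run_valid hrun.
have ys0 : ys != [::] by rewrite -size_eq0 sz -lt0n.
have tR : 0 < t%:R :> R by rewrite ltr0n.
have [eta1|eta1] := lerP eta 1; last first.
  (* Here [d >= rho], and the width bound alone suffices. *)
  rewrite slack_average // sz.
  have -> : d *: jone E = t%:R^-1 *: \sum_(y <- ys) d *: jone E.
    rewrite big_const_seq count_predT iter_addr_0 sz -(scaler_nat _ (d *: _)) !scalerA.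
    by rewrite mulKf // gt_eqF.
  rewrite -scalerDr -big_split; apply: jconeZ; first by rewrite invr_ge0 ltW.
  rewrite big_seq; apply: jcone_sum => // y /hys[_ _ hy] /=.
  apply: jnorm_inf_shift => //; apply: le_trans hy _.
  have : rho <= rho * eta by rewrite ler_peMr ?ltW.
  by move: (rho0) hd; lra.
have := run_potential (ltW eta0) eta1 hrun; set X := expo ys => hX.
have [fr XE] := spectralP hE X e0; have [fI _ _] := fr.
have rE : (jrank E)%:R = expR (eta ^+ 2 * t%:R).
  by rewrite etaE lnK // posrE ltr0n jrank_gt0.
have lamX i : (spectral E X).1 i <= 2 * (eta ^+ 2 * t%:R).
  rewrite -ler_expR; apply: le_trans (jexp_eigen_le hE e0 X i) _.
  apply: le_trans hX _; rewrite rE -expRD -mulr_natr ler_expR; lra.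
have -> : slack a c (average ys) = - (rho / (eta * t%:R)) *: X.
  rewrite slack_average // /X scalerA sz; congr (_ *: _).
  by field; rewrite !gt_eqF.
rewrite XE scaler_sumr (jordan_frame_scale _ fr) -big_split.
apply: jcone_sum => // i _ /=; rewrite scalerA -scalerDl; apply: jconeZ; last first.
  by apply: jcone_idempotent; case: (fI i).
rewrite mulNr addrC subr_ge0; apply: le_trans hd.
rewrite mulrAC ler_pdivrMr ?mulr_gt0 //.
apply: le_trans (ler_wpM2l (ltW rho0) (lamX i)) _.
by rewrite le_eqVlt; apply/orP; left; apply/eqP; ring.
Qed.

End Run.

Theorem theorem2 (R : realType) (J J' : vectType R) (E : eja J) (E' : eja J')
    (hE : trace_form E) (hE' : trace_form E')
    (m : nat) (c : J) (a : 'I_m.+1 -> J) (c' : J') (a' : 'I_m.+1 -> J')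
    (b : 'rV[R]_m.+1) (OPT : R)
    (hdual : strong_duality E E' c a c' a' b OPT)
    (ham : a ord_max = jone E) (ham' : jcone E' (a' ord_max))
    (bm : R) (hbm : bm = b 0 ord_max) (hbm0 : 0 < bm)
    (eps alpha rho : R) (heps : 0 < eps) (halpha : 0 < alpha) (hrho : 0 < rho)
    (oracle : J -> option 'rV[R]_m.+1)
    (horacle : is_oracle E E' c a c' a' b alpha oracle)
    (hwidth : oracle_width E c a oracle rho)
    (T : nat)
    (hT : Posz T = Num.ceil (4 * bm ^+ 2 * rho ^+ 2 * ln ((jrank E)%:R : R)
                             / (eps ^+ 2 * alpha ^+ 2)))
    (hT1 : (1 <= T)%N)
    (eta : R) (heta : eta = Num.sqrt (ln ((jrank E)%:R : R) / T%:R)) :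
  (meta_run E c a rho eta oracle T = None /\ alpha < OPT)
  \/
  (exists ys : seq 'rV[R]_m.+1,
     let ytilde : 'rV[R]_m.+1 :=
       \row_j (average ys 0 j + if j == ord_max then eps * alpha / bm else 0) in
     [/\ meta_run E c a rho eta oracle T = Some ys,
         OPT <= (1 + eps) * alpha,
         dual_feasible E E' c a c' a' ytilde &
         objective b ytilde <= (1 + eps) * alpha]).
Proof.
have T0 : 0 < T%:R :> R by rewrite ltr0n.
set lr := ln (jrank E)%:R in hT heta.
set K := _ / _ in hT.
have KE : K = (2 * bm * rho / (eps * alpha)) ^+ 2 * lr.
  by rewrite /K; field; rewrite !gt_eqF.
have KT : K <= T%:R by have := ceil_ge K; rewrite -hT.
(* [T >= 1] makes the ceiling positive, hence [K] and [ln r] too. This excludes the zero algebra,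
   where [r = 0] and [ln 0 = 0]. *)
have K0 : 0 < K by rewrite -ceil_gt0 -hT.
have lr0 : 0 < lr by move: K0; rewrite KE pmulr_rgt0 // exprn_gt0 // divr_gt0 // !mulr_gt0.
have e0 : jone E != 0.
  by apply: contraTneq lr0 => /jone_eq0_rank; rewrite /lr => ->; rewrite ln0 ?ltxx.
have eta2 : eta ^+ 2 = lr / T%:R by rewrite heta sqr_sqrtr // divr_ge0 ?ltW.
have eta0 : 0 < eta by rewrite heta sqrtr_gt0 divr_gt0.
have [_ inf_dual [yopt [Kyopt Kyopt'] yoptE]] := hdual.
case hrun: (meta_run E c a rho eta oracle T) => [ys|]; [right|left].
  have [sz hys] := run_valid hE e0 hrho horacle hwidth hrun.
  have ys0 : ys != [::] by rewrite -size_eq0 sz -lt0n.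
  exists ys => yt.
  have d0 : 0 <= eps * alpha / bm by rewrite ltW // divr_gt0 // mulr_gt0.
  have obj : objective b yt <= (1 + eps) * alpha.
    rewrite objective_shift -hbm mulrC divfK ?gt_eqF // mulrDl mul1r lerD2r.
    by apply: objective_average_le => // y /hys[].
  have feas : dual_feasible E E' c a c' a' yt.
    split; rewrite slack_shift.
      rewrite ham; apply: (run_slack hE e0 hrho horacle hwidth hrun) => //.
        by rewrite eta2 divfK ?gt_eqF.
      (* Squared, [2 rho eta <= eps alpha / bm] amounts to [K <= T]. *)
      rewrite -ler_sqr ?nnegrE // ?(ltW (mulr_gt0 (mulr_gt0 _ hrho) eta0)) // exprMn eta2.
      rewrite mulrA ler_pdivrMr //.
      have := ler_wpM2l (sqr_ge0 (eps * alpha / bm)) KT.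
      apply: le_trans; rewrite KE le_eqVlt; apply/orP; left; apply/eqP.
      by field; rewrite !gt_eqF.
    (* The shift adds a nonnegative multiple of [a'_m], which lies in the second cone. *)
    apply: jconeD => //; last exact: jconeZ.
    rewrite slack_average //; apply: jconeZ; first by rewrite invr_ge0.
    by rewrite big_seq; apply: jcone_sum => // y /hys[].
  split=> //; apply: le_trans obj; rewrite -lee_fin -inf_dual.
  by apply: ereal_inf_lbound; exists yt.
(* If [OPT <= alpha], the dual optimum would answer every query, as its slack and the query both lie
   in the cone. *)
split=> //; rewrite ltNge; apply/negP => hOPT.
have [ys hys] := run_None hrun.
have pd : density E (next_point E c a rho eta ys) by exact: next_density.
have := horacle _ pd; rewrite hys => /(_ yopt); apply; split=> //; last by rewrite yoptE.
by apply: jcone_inner_ge0 => //; case: pd.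
Qed.
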